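(* For any pseudo-hoop $A$, every type II state operator on $A$ is a type III state operator on $A$.
   Context: A pseudo-hoop is an algebra $(A,\odot,\rightarrow,\rightsquigarrow,1)$ of type $(2,2,2,0)$ such that for all $x,y,z\in A$: $x\odot 1=1\odot x=x$; $x\rightarrow x=x\rightsquigarrow x=1$; $(x\odot y)\rightarrow z=x\rightarrow(y\rightarrow z)$; $(x\odot y)\rightsquigarrow z=y\rightsquigarrow(x\rightsquigarrow z)$; $(x\rightarrow y)\odot x=(y\rightarrow x)\odot y=x\odot(x\rightsquigarrow y)=y\odot(y\rightsquigarrow x)$. The order is $x\le y$ iff $x\rightarrow y=1$; $(A,\le)$ is a meet-semilattice with $x\wedge y=(x\rightarrow y)\odot x$. Put $x\vee_1 y=(x\rightarrow y)\rightsquigarrow y$, $x\vee_2 y=(x\rightsquigarrow y)\rightarrow y$. For $\mu:A\to A$ and all $x,y$ consider: (IS1') $\mu(x\rightarrow y)=\mu(y\vee_1 x)\rightarrow\mu(y)$ and $\mu(x\rightsquigarrow y)=\mu(y\vee_2 x)\rightsquigarrow\mu(y)$; (IS1'') $\mu(x\rightarrow y)=\mu(x)\rightarrow\mu(x\wedge y)$ and $\mu(x\rightsquigarrow y)=\mu(x)\rightsquigarrow\mu(x\wedge y)$; (IS2) $\mu(x\odot y)=\mu(x)\odot\mu(x\rightsquigarrow x\odot y)=\mu(y\rightarrow x\odot y)\odot\mu(y)$; (IS3) $\mu(\mu(x)\odot\mu(y))=\mu(x)\odot\mu(y)$; (IS4) $\mu(\mu(x)\rightarrow\mu(y))=\mu(x)\rightarrow\mu(y)$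 and $\mu(\mu(x)\rightsquigarrow\mu(y))=\mu(x)\rightsquigarrow\mu(y)$. A type II state operator satisfies (IS1'),(IS2),(IS3),(IS4); a type III state operator satisfies (IS1''),(IS2),(IS3),(IS4). *)

(* Defs.v *)
Set Implicit Arguments.
Unset Strict Implicit.
Unset Printing Implicit Defensive.

Declare Scope hoop_scope.
Delimit Scope hoop_scope with hoop.

Reserved Notation "x ⊙ y" (at level 40, left associativity).
Reserved Notation "x → y" (at level 55, no associativity).
Reserved Notation "x ⇝ y" (at level 55, no associativity).
Reserved Notation "x ∧ y" (at level 45, left associativity).
Reserved Notation "x ∨₁ y" (at level 50, no associativity).
Reserved Notation "x ∨₂ y" (at level 50, no associativity).

Record pseudoHoop : Type := PseudoHoop {
  carrier :> Type;
  pmul : carrier -> carrier -> carrier where "x ⊙ y" := (pmul x y);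
  pimpl : carrier -> carrier -> carrier where "x → y" := (pimpl x y);
  pimpr : carrier -> carrier -> carrier where "x ⇝ y" := (pimpr x y);
  pone : carrier;
  pmulx1 : forall x, x ⊙ pone = x;
  pmul1x : forall x, pone ⊙ x = x;
  pimplxx : forall x, (x → x) = pone;
  pimprxx : forall x, (x ⇝ x) = pone;
  pimpl_mul : forall x y z, ((x ⊙ y) → z) = (x → (y → z));
  pimpr_mul : forall x y z, ((x ⊙ y) ⇝ z) = (y ⇝ (x ⇝ z));
  pdivl : forall x y, (x → y) ⊙ x = (y → x) ⊙ y;
  pdivlr : forall x y, (y → x) ⊙ y = x ⊙ (x ⇝ y);
  pdivr : forall x y, x ⊙ (x ⇝ y) = y ⊙ (y ⇝ x)
}.

Notation "x ⊙ y" := (pmul x y) : hoop_scope.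
Notation "x → y" := (pimpl x y) : hoop_scope.
Notation "x ⇝ y" := (pimpr x y) : hoop_scope.

Local Open Scope hoop_scope.

Definition ple (A : pseudoHoop) (x y : A) : Prop := (x → y) = pone A.

(* The meet of x and y for the order ple. *)
Definition pmeet (A : pseudoHoop) (x y : A) : A := (x → y) ⊙ x.

(* In general neither of these is commutative or a join for ple. *)
Definition pvee1 (A : pseudoHoop) (x y : A) : A := (x → y) ⇝ y.
Definition pvee2 (A : pseudoHoop) (x y : A) : A := (x ⇝ y) → y.

Notation "x ∧ y" := (pmeet x y) : hoop_scope.
Notation "x ∨₁ y" := (pvee1 x y) : hoop_scope.
Notation "x ∨₂ y" := (pvee2 x y) : hoop_scope.

Definition IS1' (A : pseudoHoop) (mu : A -> A) : Prop :=
  forall x y : A,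
    mu (x → y) = (mu (y ∨₁ x) → mu y) /\
    mu (x ⇝ y) = (mu (y ∨₂ x) ⇝ mu y).

Definition IS1'' (A : pseudoHoop) (mu : A -> A) : Prop :=
  forall x y : A,
    mu (x → y) = (mu x → mu (x ∧ y)) /\
    mu (x ⇝ y) = (mu x ⇝ mu (x ∧ y)).

Definition IS2 (A : pseudoHoop) (mu : A -> A) : Prop :=
  forall x y : A,
    mu (x ⊙ y) = mu x ⊙ mu (x ⇝ (x ⊙ y)) /\
    mu (x ⊙ y) = mu (y → (x ⊙ y)) ⊙ mu y.

Definition IS3 (A : pseudoHoop) (mu : A -> A) : Prop :=
  forall x y : A, mu (mu x ⊙ mu y) = mu x ⊙ mu y.

Definition IS4 (A : pseudoHoop) (mu : A -> A) : Prop :=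
  forall x y : A,
    mu (mu x → mu y) = (mu x → mu y) /\
    mu (mu x ⇝ mu y) = (mu x ⇝ mu y).

Definition type_II_state_operator (A : pseudoHoop) (mu : A -> A) : Prop :=
  IS1' mu /\ IS2 mu /\ IS3 mu /\ IS4 mu.

Definition type_III_state_operator (A : pseudoHoop) (mu : A -> A) : Prop :=
  IS1'' mu /\ IS2 mu /\ IS3 mu /\ IS4 mu.

(* Main.v *)
Require Import Defs.

(** Since [x → y = x → (x ∧ y)] and [(x ∧ y) ∨₁ x = x], (IS1'') is the
    instance of (IS1') at the pair [x], [x ∧ y].  The second half of each axiom
    is the first half read in the opposite pseudo-hoop. *)

Local Open Scope hoop_scope.

(* With [u = x → 1] and [v = u → 1], the divisibility axiom gives [u = v ⊙ u],
   hence [v → 1 = 1], and [x = v ⊙ (1 → x)] with [(1 → x) → 1 = 1];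
   so [u = v → ((1 → x) → 1) = v → 1 = 1]. *)
Lemma pimplx1 (A : pseudoHoop) (x : A) : (x → pone A) = pone A.
Proof.
  set (u := x → pone A).
  set (v := u → pone A).
  assert (H1u : (pone A → u) = u).
  { unfold u. now rewrite <- pimpl_mul, pmul1x. }
  assert (Hu : v ⊙ u = u).
  { unfold v. now rewrite pdivl, H1u, pmulx1. }
  assert (Hv : (v → pone A) = pone A).
  { transitivity (v → (u → u)); [now rewrite pimplxx|].
    rewrite <- pimpl_mul, Hu. apply pimplxx. }
  assert (Hb : (pone A → x) = u ⊙ x).
  { unfold u. now rewrite pdivl, pmulx1. }
  assert (Hx : v ⊙ (u ⊙ x) = x).
  { assert (Hvb : (u ⊙ x → x) = v).
    { now rewrite pimpl_mul, pimplxx. }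
    (* Divisibility yields [(x → u ⊙ x) ⊙ x], and [x → (1 → x) = (x ⊙ 1) → x = 1]. *)
    rewrite <- Hvb, pdivl, <- Hb, <- pimpl_mul, pmulx1, pimplxx.
    apply pmul1x. }
  transitivity (v ⊙ (u ⊙ x) → pone A); [now rewrite Hx|].
  rewrite pimpl_mul, pimpl_mul.
  fold u. now rewrite pimplxx.
Qed.

Lemma ple_antisym (A : pseudoHoop) (x y : A) : ple x y -> ple y x -> x = y.
Proof.
  unfold ple. intros Hxy Hyx.
  transitivity ((x → y) ⊙ x); [now rewrite Hxy, pmul1x|].
  now rewrite pdivl, Hyx, pmul1x.
Qed.

Lemma pmeet_ler (A : pseudoHoop) (x y : A) : ple (x ∧ y) y.
Proof. unfold ple, pmeet. now rewrite pimpl_mul, pimplxx. Qed.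

Lemma pmeetC (A : pseudoHoop) (x y : A) : x ∧ y = y ∧ x.
Proof. apply pdivl. Qed.

Lemma pmeet_lel (A : pseudoHoop) (x y : A) : ple (x ∧ y) x.
Proof. rewrite pmeetC. apply pmeet_ler. Qed.

Lemma pimpl_meet (A : pseudoHoop) (x y : A) : (x → (x ∧ y)) = (x → y).
Proof.
  apply ple_antisym; unfold ple.
  (* Divisibility turns [(x → (x ∧ y)) ⊙ x] into [((x ∧ y) → x) ⊙ (x ∧ y)], whose last factor is
     below [y]. *)
  - rewrite <- pimpl_mul, pdivl, pimpl_mul, pmeet_ler. apply pimplx1.
  - rewrite <- pimpl_mul. apply pimplxx.
Qed.

(** The carrier is unchanged up to conversion, so the same [mu] acts on both hoops. *)
Definition opposite_hoop (A : pseudoHoop) : pseudoHoop :=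
  @PseudoHoop A (fun x y => pmul y x) (@pimpr A) (@pimpl A) (pone A)
    (@pmul1x A) (@pmulx1 A) (@pimprxx A) (@pimplxx A)
    (fun x y z => pimpr_mul y x z) (fun x y z => pimpl_mul y x z)
    (@pdivr A) (fun x y => eq_sym (pdivlr y x)) (@pdivl A).

Lemma pimpr1x (A : pseudoHoop) (x : A) : (pone A ⇝ x) = x.
Proof.
  transitivity (pone A ⊙ (pone A ⇝ x)); [now rewrite pmul1x|].
  now rewrite <- pdivlr, pimplx1, pmul1x.
Qed.

(** The mixed law [pdivlr] makes the meet independent of the arrow used. *)
Lemma pmeet_opposite (A : pseudoHoop) (x y : A) :
  @pmeet (opposite_hoop A) x y = x ∧ y.
Proof. unfold pmeet. simpl. now rewrite <- pdivlr, pdivl. Qed.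

(** Exchanging the arrows exchanges [∨₁] and [∨₂], so the two equations trade places. *)
Lemma IS1'_opposite (A : pseudoHoop) (mu : A -> A) :
  IS1' mu -> @IS1' (opposite_hoop A) mu.
Proof. intros H x y. destruct (H x y). now split. Qed.

Lemma IS1'_impl_meet (A : pseudoHoop) (mu : A -> A) (x y : A) :
  IS1' mu -> mu (x → y) = (mu x → mu (x ∧ y)).
Proof.
  intros H. rewrite <- pimpl_meet.
  destruct (H x (x ∧ y)) as [-> _].
  (* As [x ∧ y] is below [x], [(x ∧ y) ∨₁ x] reduces to [1 ⇝ x]. *)
  unfold pvee1. now rewrite pmeet_lel, pimpr1x.
Qed.

Theorem theorem5p12 (A : pseudoHoop) (mu : A -> A)
  (hmu : type_II_state_operator mu) : type_III_state_operator mu.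
Proof.
  destruct hmu as [H1 H]. split; [intros x y; split | exact H].
  - now apply IS1'_impl_meet.
  - rewrite <- pmeet_opposite.
    exact (IS1'_impl_meet (opposite_hoop A) mu x y (IS1'_opposite A mu H1)).
Qed.
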